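(* Let $\mathcal{D}\subseteq\mathbb{R}^n$ be bounded and closed, and let $f=(f_1,\dots,f_m)^T:\mathcal{D}\to\mathbb{R}^m$ satisfy the following conditions. (i) $f$ is differentiable on $\mathcal{D}$ with continuous derivative $f'$. (ii) $f$ satisfies the local tangential cone condition in $\mathcal{D}$: there are constants $\xi_1,\dots,\xi_m\ge 0$ with $\xi:=\max_{1\le i\le m}\xi_i\le\frac12$ such that $|f_i(y)-f_i(z)-f_i'(y)(y-z)|\le \xi_i|f_i(y)-f_i(z)|$ for all $y,z\in\mathcal{D}$ and all $1\le i\le m$. (iii) There is $x^\dagger\in\mathcal{D}$ with $f(x^\dagger)=0$. (iv) $\mathcal{N}(f'(x^\dagger))\subseteq\mathcal{N}(f'(x))$ for all $x\in\mathcal{D}$. Let $x_0\in\mathcal{D}$, and let $x^\dagger$ be the solution of $f(x)=0$ in $\mathcal{D}$ of minimal distance to $x_0$, which satisfies $x^\dagger-x_0\in\mathcal{R}(f'(x^\dagger)^T)$. Let $q\ge2$ be an integer, let $\omega\in[0,1)$, and let $\alpha=\max_{1\le i\le m}\sup_{x\in\mathcal{D}}\|f_i'(x)\|^2$. Put $$a_1=1+3\omega+2\omega^2-(1-2\xi+3\omega-4\omega\xi)\frac{m^{1-q}\sigma_{\min}^2(f'(x^\dagger))}{\alpha(1+\xi)^2},\qquad a_2=\omega+2\omega^2,$$ and assume $a_1+a_2<1$. Let $\{x_k\}\subset\mathcal{D}$ be the sequence generated from $x_0$ by the RBWNK-m method (defined in the context) with parameters $q$ and $\omega$. Then for every $k\ge1$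 for which $x_{k+1}$ is generated, $$\|x_{k+1}-x^\dagger\|^2\le p_1^k(1+b_1)\|x_0-x^\dagger\|^2,$$ where $p_1=\frac{a_1+\sqrt{a_1^2+4a_2}}{2}$, $b_1=p_1-a_1$, and $a_1+a_2\le p_1<1$.
   Context: Notation: $\|\cdot\|$ is the Euclidean norm; $[m]=\{1,\dots,m\}$; $f'(x)\in\mathbb{R}^{m\times n}$ is the Jacobian matrix of $f$ at $x$ and $f_i'(x)$ is its $i$th row; $\mathcal{N}(A)$ is the null space and $\mathcal{R}(A)$ the column space of a matrix $A$; $\sigma_{\min}(A)$ is the smallest nonzero singular value of $A$. For $\tau\subseteq[m]$, $f_\tau$ and $f'_\tau$ denote the restrictions of $f$ and of the rows of $f'$ to the indices in $\tau$. RBWNK-m method (residual-based weighted nonlinear Kaczmarz method with momentum): set $x_1=x_0$. For $k=1,2,\dots$, as long as $f(x_k)\ne0$ (the method stops otherwise), let $$\delta_k=\frac12\left(\frac{\max_{i\in[m]}|f_i(x_k)|^2}{\|f(x_k)\|^2}+\frac1m\right),\qquad \tau_k=\{i\in[m]: |f_i(x_k)|^2\ge\delta_k\|f(x_k)\|^2\},$$ let $\eta_k\in\mathbb{R}^{|\tau_k|}$ be the vector with entries, for $i\in\tau_k$, $\eta_k^{(i)}=f_i(x_k)^{q-1}$ if $q$ is even and $\eta_k^{(i)}=|f_i(x_k)^{q-2}|\,f_i(x_k)$ if $q$ is odd, and set $$x_{k+1}=x_k-\frac{\eta_k^Tf_{\tau_k}(x_k)}{\|f'_{\tau_k}(x_k)^T\eta_k\|^2}f'_{\tau_k}(x_k)^T\eta_k+\omega(x_k-x_{k-1}).$$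 *)

(* Defs.v *)
From mathcomp Require Import all_boot all_order all_algebra.
From mathcomp Require Import all_classical all_reals all_analysis.
Import Order.TTheory GRing.Theory Num.Theory numFieldNormedType.Exports.

Set Implicit Arguments.
Unset Strict Implicit.
Unset Printing Implicit Defensive.

Local Open Scope classical_set_scope.
Local Open Scope ring_scope.

(* The library norm on matrices is the sup norm, which induces the same
   topology and the same bounded sets; this is the Euclidean norm of a row or
   column vector. *)
Definition enorm (R : realType) (p r : nat) (v : 'M[R]_(p, r)) : R :=
  Num.sqrt (\sum_i \sum_j v i j ^+ 2).

(* The singular values of A are the square roots of the eigenvalues of A^T A.
   This is a minimum when A <> 0, and inf set0 = 0 when A = 0. *)
Definition sigma_min (R : realType) (m n : nat) (A : 'M[R]_(m, n)) : R :=
  inf [set s : R | 0 < s /\ eigenvalue (A^T *m A) (s ^+ 2)].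

(* f matters only on D, which need not be open: A is a derivative of f at x
   relative to D. *)
Definition jacobian_within (R : realType) (m n : nat) (D : set 'cV[R]_n)
    (f : 'cV[R]_n -> 'cV[R]_m) (x : 'cV[R]_n) (A : 'M[R]_(m, n)) : Prop :=
  forall eps : R, 0 < eps -> \forall y \near within D (nbhs x),
    enorm (f y - f x - A *m (y - x)) <= eps * enorm (y - x).

(* J stands for f', so that row i (J y) is f_i'(y). *)
Definition tangential_cone (R : realType) (m n : nat) (D : set 'cV[R]_n)
    (f : 'cV[R]_n -> 'cV[R]_m) (J : 'cV[R]_n -> 'M[R]_(m, n))
    (xi : 'I_m -> R) : Prop :=
  forall y z i, D y -> D z ->
    `|f y i 0 - f z i 0 - (row i (J y) *m (y - z)) 0 0|
      <= xi i * `|f y i 0 - f z i 0|.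

Section RBWNKm.
Context (R : realType) (m n : nat).
Implicit Types (f : 'cV[R]_n -> 'cV[R]_m) (J : 'cV[R]_n -> 'M[R]_(m, n)).

Definition rbwnk_delta f (x : 'cV[R]_n) : R :=
  2^-1 * ((\big[Num.max/0]_(i < m) `|f x i 0| ^+ 2) / enorm (f x) ^+ 2
          + m%:R^-1).

Definition rbwnk_tau f (x : 'cV[R]_n) : {set 'I_m} :=
  [set i | rbwnk_delta f x * enorm (f x) ^+ 2 <= `|f x i 0| ^+ 2]%SET.

(* rowsub (restr tau) A keeps the rows of A with index in tau. *)
Definition restr (tau : {set 'I_m}) : 'I_#|tau| -> 'I_m := @enum_val _ (mem tau).

Definition rbwnk_weight (q : nat) (a : R) : R :=
  if odd q then `|a ^+ (q - 2)| * a else a ^+ (q - 1).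

Definition rbwnk_eta (q : nat) f (x : 'cV[R]_n) : 'cV[R]_#|rbwnk_tau f x| :=
  map_mx (rbwnk_weight q) (rowsub (restr (tau := rbwnk_tau f x)) (f x)).

Definition rbwnkm_step (q : nat) (omega : R) f J (x xprev : 'cV[R]_n) :
    'cV[R]_n :=
  let ftau := rowsub (restr (tau := rbwnk_tau f x)) (f x) in
  let Jtau := rowsub (restr (tau := rbwnk_tau f x)) (J x) in
  let eta := rbwnk_eta q f x in
  x - ((eta^T *m ftau) 0 0 / enorm (Jtau^T *m eta) ^+ 2) *: (Jtau^T *m eta)
    + omega *: (x - xprev).

(* The method reaches the iterate x_k: it has not stopped at any of
   x_1, ..., x_(k-1). *)
Definition generated f (x : nat -> 'cV[R]_n) (k : nat) : Prop :=
  forall j, (1 <= j < k)%N -> f (x j) <> 0.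

(* x_k is unconstrained for the indices k that are not generated. *)
Definition rbwnkm_sequence (q : nat) (omega : R) f J (x0 : 'cV[R]_n)
    (x : nat -> 'cV[R]_n) : Prop :=
  [/\ x 0%N = x0, x 1%N = x0
    & forall k, (1 <= k)%N -> generated f x k.+1 ->
        x k.+1 = rbwnkm_step q omega f J (x k) (x k.-1)].

End RBWNKm.

(* Main.v *)
(* With e_k = x_k - xd and a = e_k - t g the point reached by the Kaczmarz step
   of direction g, the momentum cross term is split by
     2 <a, e_k> = |a|^2 + |e_k|^2 - t^2 |g|^2  and
     - 2 <a, e_(k-1)> <= |a|^2 + |e_(k-1)|^2,
   while the tangential cone condition gives |a|^2 <= |e_k|^2 - (1 - 2 xi) T for
   T = t^2 |g|^2.  On tau_k every residual is at least |f(x_k)| / sqrt m, hence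
   T >= |f(x_k)|^2 / (m alpha).  By the kernel inclusion e_k stays in the range
   of J(xd)^T, where |J(xd) e_k| >= sigma_min |e_k|, so the cone condition
   bounds |f(x_k)| from below by a multiple of |e_k|.  This yields
   |e_(k+1)|^2 <= a1 |e_k|^2 + a2 |e_(k-1)|^2, and p1 is the larger root of
   p^2 = a1 p + a2. *)
Require Import Defs.
From mathcomp Require Import all_boot all_order all_algebra.
From mathcomp Require Import all_classical all_reals all_analysis.
From mathcomp Require Import ring lra zify.
Import Order.TTheory GRing.Theory Num.Theory numFieldNormedType.Exports.
Local Open Scope classical_set_scope.
Local Open Scope ring_scope.
Set Implicit Arguments.
Unset Strict Implicit.
Unset Printing Implicit Defensive.

(** * The Frobenius inner product and its norm [enorm] *)

Definition edot (R : realType) (p r : nat) (u v : 'M[R]_(p, r)) : R :=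
  \tr (u^T *m v).

Section EuclideanDot.
Context (R : realType).

Lemma edotE p r (u v : 'M[R]_(p, r)) : edot u v = \sum_i \sum_j u i j * v i j.
Proof.
rewrite exchange_big; apply: eq_bigr => j _; rewrite mxE.
by apply: eq_bigr => i _; rewrite mxE.
Qed.

Lemma edotC p r (u v : 'M[R]_(p, r)) : edot u v = edot v u.
Proof. by rewrite /edot -mxtrace_tr trmx_mul trmxK. Qed.

Lemma edotDl p r (u v w : 'M[R]_(p, r)) : edot (u + v) w = edot u w + edot v w.
Proof. by rewrite /edot linearD mulmxDl mxtraceD. Qed.

Lemma edotZl p r a (u v : 'M[R]_(p, r)) : edot (a *: u) v = a * edot u v.
Proof. by rewrite /edot linearZ -scalemxAl mxtraceZ. Qed.

Lemma edotNl p r (u v : 'M[R]_(p, r)) : edot (- u) v = - edot u v.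
Proof. by rewrite -scaleN1r edotZl mulN1r. Qed.

Lemma edotDr p r (u v w : 'M[R]_(p, r)) : edot u (v + w) = edot u v + edot u w.
Proof. by rewrite edotC edotDl !(edotC u). Qed.

Lemma edotZr p r a (u v : 'M[R]_(p, r)) : edot u (a *: v) = a * edot u v.
Proof. by rewrite edotC edotZl edotC. Qed.

Lemma edotNr p r (u v : 'M[R]_(p, r)) : edot u (- v) = - edot u v.
Proof. by rewrite edotC edotNl edotC. Qed.

Lemma edot_mull p r s (A : 'M[R]_(p, r)) (u : 'M[R]_(r, s)) (v : 'M[R]_(p, s)) :
  edot (A *m u) v = edot u (A^T *m v).
Proof. by rewrite /edot trmx_mul mulmxA. Qed.

Lemma edot_mulr p r s (A : 'M[R]_(p, r)) (u : 'M[R]_(r, s)) (v : 'M[R]_(p, s)) :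
  edot v (A *m u) = edot (A^T *m v) u.
Proof. by rewrite edotC edot_mull edotC. Qed.

Lemma sqr_enorm p r (v : 'M[R]_(p, r)) : enorm v ^+ 2 = edot v v.
Proof.
rewrite sqr_sqrtr ?edotE //.
by do 2!apply: sumr_ge0 => ? _; rewrite sqr_ge0.
Qed.

Lemma edot_ge0 p r (v : 'M[R]_(p, r)) : 0 <= edot v v.
Proof. by rewrite -sqr_enorm sqr_ge0. Qed.

Lemma edot_eq0 p r (v : 'M[R]_(p, r)) : edot v v = 0 -> v = 0.
Proof.
rewrite edotE => v0; apply/matrixP => i j; rewrite mxE.
have /psumr_eq0P h := v0.
have /psumr_eq0P h' : \sum_j v i j * v i j = 0.
  by apply: h => // k _; apply: sumr_ge0 => ? _; rewrite -expr2 sqr_ge0.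
apply/eqP; rewrite -sqrf_eq0 expr2; apply/eqP/h' => // k _.
by rewrite -expr2 sqr_ge0.
Qed.

Lemma edot_tr p r (u v : 'M[R]_(p, r)) : edot u^T v^T = edot u v.
Proof. by rewrite edotC /edot trmxK mxtrace_mulC. Qed.

Lemma edotDD p r (u v : 'M[R]_(p, r)) :
  edot (u + v) (u + v) = edot u u + 2 * edot u v + edot v v.
Proof. by rewrite !(edotDl, edotDr) (edotC v u); ring. Qed.

End EuclideanDot.

(** * Compactness and continuity in coordinate spaces *)

Section Compactness.
Context (R : realType).

Lemma trmx_continuous p r : continuous (fun M : 'M[R]_(p, r) => M^T).
Proof.
move=> M s /= /nbhs_ballP[e e0 es]; apply/nbhs_ballP; exists e => // N [_ MN].
by apply: es; split => // i j; rewrite !mxE; exact: MN.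
Qed.

(** Transposition is continuous and preserves the sup norm, which carries [bounded_closed_compact]
    from rows to columns. *)
Lemma cV_bounded_closed_compact n (A : set 'cV[R]_n) :
  bounded_set A -> closed A -> compact A.
Proof.
move=> Ab Acl.
have -> : A = (fun v : 'rV[R]_n => v^T) @` [set v | A v^T].
  rewrite eqEsubset; split => [v Av|v [w Aw <-] //].
  by exists v^T; rewrite /= ?trmxK.
apply: continuous_compact.
  exact/continuous_subspaceT/trmx_continuous.
apply: bounded_closed_compact.
  case: Ab => M [Mr AM]; exists M; split => // y My v /= /(AM _ My).
  rewrite /Num.norm /= !mx_normrE => H; apply/bigmax_leP; split.
    exact: le_trans (bigmax_ge_id _ _ _ _) H.
  move=> [i j] _ /=; apply: le_trans H.
  rewrite -[v i j]/(v (i, j).1 (i, j).2).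
  by rewrite (le_trans _ (le_bigmax _ _ (j, i))) //= mxE.
by apply: closed_comp Acl => v _; exact: trmx_continuous.
Qed.

Lemma sqr_enorm_mulmx_continuous n p (B : 'M[R]_(n, p)) :
  continuous (fun v : 'rV[R]_n => enorm (v *m B) ^+ 2).
Proof.
have -> : (fun v : 'rV[R]_n => enorm (v *m B) ^+ 2) =
    (fun v => \sum_j (\sum_k v 0 k * B k j) ^+ 2).
  apply/funext => v; rewrite sqr_enorm edotE big_ord1.
  by apply: eq_bigr => j _; rewrite !mxE -expr2.
have lin_cont j : continuous (fun v : 'rV[R]_n => \sum_k v 0 k * B k j).
  apply: continuous_big => [|k _ v]; first exact: add_continuous.
  apply: (@cvgM _ _ (nbhs v) _ (fun v => v 0 k) (fun=> B k j)).
    exact: coord_continuous.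
  exact: cvg_cst.
apply: continuous_big => [|j _ v]; first exact: add_continuous.
exact: (@cvgM _ _ (nbhs v) _ _ _ _ _ (lin_cont j v) (lin_cont j v)).
Qed.

End Compactness.

(** * The smallest singular value as a lower bound on the range of A^T *)

Section SmallestSingularValue.
Context (R : realType) (m n : nat).
Implicit Type A : 'M[R]_(m, n).

(** Extreme value theorem on the unit vectors of the range of A^T, extended to all [z] by
    homogeneity; [u] ensures that such a unit vector exists. *)
Lemma min_on_range A (u : 'cV[R]_m) : A^T *m u != 0 ->
  exists2 w : 'cV[R]_m, edot (A^T *m w) (A^T *m w) = 1
    & forall z : 'cV[R]_m,
        edot (A *m (A^T *m w)) (A *m (A^T *m w)) * edot (A^T *m z) (A^T *m z)
          <= edot (A *m (A^T *m z)) (A *m (A^T *m z)).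
Proof.
move=> u0; pose K := cokermx A.
(* Membership in the row space is a vanishing norm, and [1%:M] gives both conditions the same shape,
   so one closedness argument [cl] serves both. *)
pose S := [set v : 'rV[R]_n | enorm (v *m 1%:M) ^+ 2 = 1] `&`
          [set v : 'rV[R]_n | enorm (v *m K) ^+ 2 = 0].
have SE v : S v <-> edot v v = 1 /\ exists z : 'cV[R]_m, v^T = A^T *m z.
  rewrite /S /= mulmx1 !sqr_enorm; split=> -[-> h]; split=> //.
    have /submxP[w ->] : (v <= A)%MS by rewrite submxE; apply/eqP/edot_eq0.
    by exists w^T; rewrite trmx_mul.
  case: h => z /(congr1 trmx); rewrite trmx_mul !trmxK => ->.
  by rewrite -mulmxA mulmx_coker mulmx0 edotE !big1 // => i _;
    rewrite big1 // => j _; rewrite mxE mul0r.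
have norm_mem (z : 'cV[R]_m) : A^T *m z != 0 ->
    S ((enorm (A^T *m z))^-1 *: (A^T *m z)^T).
  move=> z0; have e0 : enorm (A^T *m z) != 0.
    apply: contra z0 => /eqP e0; apply/eqP/edot_eq0.
    by rewrite -sqr_enorm e0 expr0n.
  apply/SE; split.
    by rewrite edotZl edotZr edot_tr -sqr_enorm; field.
  by exists ((enorm (A^T *m z))^-1 *: z); rewrite linearZ /= trmxK scalemxAr.
have Sc : compact S.
  apply: bounded_closed_compact.
    exists 1; split => // M M1 v /SE[v1 _]; rewrite /Num.norm /= mx_normrE.
    apply/bigmax_leP; split => [|[i j] _ /=].
      by rewrite ltW // (lt_trans ltr01).
    apply: le_trans (ltW M1); rewrite -(@ler_pXn2r _ 2) ?nnegrE //.
    rewrite expr1n -v1 edotE (bigD1 i) // (bigD1 j) //= real_normK ?num_real //.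
    rewrite -expr2 -addrA lerDl addr_ge0 //.
      by apply: sumr_ge0 => k _; rewrite -expr2 sqr_ge0.
    by do 2!apply: sumr_ge0 => ? _; rewrite -expr2 sqr_ge0.
  have cl p (B : 'M[R]_(n, p)) c :
      closed [set v : 'rV[R]_n | enorm (v *m B) ^+ 2 = c].
    apply: (@preimage_closed _ _ (fun v : 'rV[R]_n => enorm (v *m B) ^+ 2)
      [set c]).
      by move=> v _; exact: sqr_enorm_mulmx_continuous.
    exact: closed_eq.
  by apply: closedI; exact: cl.
have S0 : S !=set0 by eexists; exact: norm_mem u0.
have cont : {within S, continuous (fun v : 'rV[R]_n => enorm (v *m A^T) ^+ 2)}.
  exact/continuous_subspaceT/sqr_enorm_mulmx_continuous.
have [v /set_mem/SE[v1 [w vw]] vmin] := EVT_min_rV S0 Sc cont.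
exists w; first by rewrite -vw edot_tr.
move=> z; set v' := A^T *m z; have [v0|v0] := eqVneq v' 0.
  by rewrite v0 mulmx0 /edot !mulmx0 !mxtrace0 mulr0.
have /mem_set/vmin := norm_mem z v0.
rewrite -[v *m _]trmxK trmx_mul trmxK vw -/v'.
rewrite -scalemxAl -trmx_mul !sqr_enorm !edot_tr edotZl edotZr edot_tr.
have e0 : 0 < edot v' v'.
  by rewrite lt0r edot_ge0 andbT; apply: contra v0 => /eqP/edot_eq0 ->.
by rewrite mulrA -expr2 exprVn sqr_enorm mulrC ler_pdivlMr.
Qed.

Lemma sigma_min_ge0 A : 0 <= sigma_min A.
Proof.
rewrite /sigma_min; set S := [set s | _].
have [->|/set0P S0] := eqVneq S set0; first by rewrite inf0.
by apply: lb_le_inf => // s [/ltW].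
Qed.

(* The minimiser of |A v| over the unit vectors of the range of A^T is an
   eigenvector of A^T A, by the first-order optimality condition. *)
Lemma sigma_min_le A (z : 'cV[R]_m) :
  sigma_min A ^+ 2 * enorm (A^T *m z) ^+ 2 <= enorm (A *m (A^T *m z)) ^+ 2.
Proof.
have [z0|z0] := eqVneq (A^T *m z) 0.
  by rewrite z0 mulmx0 !sqr_enorm /edot !mulmx0 !mxtrace0 mulr0.
have [w w1 wmin] := min_on_range z0; set v := A^T *m w in w1 wmin.
set mu := edot (A *m v) (A *m v) in wmin.
(* [g] is the residual of the eigenvector equation. It lies in the range of A^T, so v + t g is an
   admissible competitor for every t. *)
have [g gdef] : exists g, g = A^T *m (A *m v) - mu *: v by eexists.
have gE : g = A^T *m (A *m v - mu *: w) by rewrite mulmxBr -scalemxAr.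
have dg : edot (A *m v) (A *m g) = edot g g + mu * edot v g.
  have gv : A^T *m (A *m v) = g + mu *: v by rewrite gdef subrK.
  by rewrite edot_mulr gv edotDl edotZl.
have g0 : g = 0.
  apply: edot_eq0; apply/eqP; rewrite eq_le edot_ge0 andbT.
  pose c := edot (A *m g) (A *m g) - mu * edot g g.
  have c0 : 0 <= c by rewrite subr_ge0 gE; exact: wmin.
  (* Minimality tested at v + t g; the terms mu and mu <v, g> cancel. *)
  have key t : 0 <= 2 * t * edot g g + t ^+ 2 * c.
    have := wmin (w + t *: (A *m v - mu *: w)).
    rewrite /= mulmxDr -scalemxAr -gE -/v mulmxDr -scalemxAr !edotDD.
    rewrite !(edotZl, edotZr) -/mu w1 dg -subr_ge0 => h.
    by apply: (le_trans h); rewrite le_eqVlt /c; apply/orP; left; apply/eqP;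
      ring.
  (* This t makes the expression a negative multiple of |g|^4; the added 1 keeps the denominator
     positive when c = 0. *)
  have := key (- (edot g g / (c + 1))).
  have -> : 2 * - (edot g g / (c + 1)) * edot g g +
      (- (edot g g / (c + 1))) ^+ 2 * c
    = - (edot g g ^+ 2 * ((c + 2) / (c + 1) ^+ 2)).
    by field; apply: lt0r_neq0; rewrite ltr_wpDl.
  rewrite oppr_ge0 pmulr_lle0 => [h|]; last first.
    by rewrite divr_gt0 ?exprn_gt0 ?ltr_wpDl.
  have : edot g g ^+ 2 = 0 by apply/eqP; rewrite eq_le h sqr_ge0.
  by move/eqP; rewrite sqrf_eq0 => /eqP ->.
(* If A v = 0, then |v|^2 = <w, A v> = 0, against |v| = 1. *)
have mu_gt0 : 0 < mu.
  rewrite lt0r edot_ge0 andbT; apply/eqP => /edot_eq0 Av0.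
  have : edot v v = 0.
    by rewrite {1}/v edot_mull trmxK Av0 /edot mulmx0 mxtrace0.
  by rewrite w1 => /eqP; rewrite oner_eq0.
have sle : sigma_min A <= Num.sqrt mu.
  apply: ge_inf; first by exists 0 => s [/ltW].
  split; first by rewrite sqrtr_gt0.
  (* [eigenvalue] refers to row eigenvectors, hence [v^T]; A^T A is symmetric. *)
  rewrite sqr_sqrtr ?(ltW mu_gt0) //; apply/eigenvalueP; exists v^T.
    move/eqP: g0; rewrite gdef subr_eq0 => /eqP/(congr1 trmx).
    by rewrite (trmx_mul A^T) (trmx_mul A) trmxK linearZ /= mulmxA.
  apply/eqP => /(congr1 trmx); rewrite trmxK trmx0 => v0.
  by move: w1; rewrite v0 /edot mulmx0 mxtrace0 => /eqP;
    rewrite eq_sym oner_eq0.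
rewrite !sqr_enorm; apply: le_trans (wmin z); apply: ler_wpM2r.
  exact: edot_ge0.
by rewrite -[mu]sqr_sqrtr ?(ltW mu_gt0) // ler_pXn2r ?nnegrE
  ?sigma_min_ge0 ?sqrtr_ge0.
Qed.

End SmallestSingularValue.

(** * The two-term recursion created by the momentum *)

Section MomentumRecursion.
Context (R : realType).

(** The roots of p^2 = a1 p + a2 are p and a1 - p. Squaring reduces p < 1 to a1 + a2 < 1, and then
    a2 = p (p - a1) <= p - a1 gives the lower bound on p. *)
Lemma momentum_root (a1 a2 : R) : 0 <= a2 -> a1 + a2 < 1 ->
  let p := (a1 + Num.sqrt (a1 ^+ 2 + 4 * a2)) / 2 in
  [/\ a1 + a2 <= p, p < 1, 0 <= p, 0 <= p - a1 & p * (p - a1) = a2].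
Proof.
move=> a2_ge0 a12 p; set s := Num.sqrt _ in p *.
have d_ge0 : 0 <= a1 ^+ 2 + 4 * a2 by rewrite addr_ge0 ?sqr_ge0 ?mulr_ge0.
have s2 : s ^+ 2 = a1 ^+ 2 + 4 * a2 by rewrite sqr_sqrtr.
have sa : `|a1| <= s by rewrite -sqrtr_sqr ler_wsqrtr // lerDl mulr_ge0.
have p_ge0 : 0 <= p by rewrite /p; have := ler_norm (- a1); rewrite normrN; lra.
have b_ge0 : 0 <= p - a1 by rewrite /p; have := ler_norm a1; lra.
have pb : p * (p - a1) = a2.
  have -> : p * (p - a1) = (s ^+ 2 - a1 ^+ 2) / 4 by rewrite /p; field.
  by rewrite s2; field.
have p_lt1 : p < 1.
  suff : s < 2 - a1 by rewrite /p; lra.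
  rewrite -(@ltr_pXn2r _ 2) ?nnegrE ?sqrtr_ge0 //; last by lra.
  by rewrite s2; nra.
split=> //; rewrite -lerBrDl -{1}pb; nra.
Qed.

(** With b = p - a1, the quantity F (k+1) + b F k shrinks by the factor p at each step, because a1 +
    b = p and a2 = p b. The factor 1 + b comes from F 1 = F 0. *)
Lemma momentum_recursion (a1 a2 p : R) (F : nat -> R) (K : nat) :
  0 <= p -> 0 <= p - a1 -> p * (p - a1) = a2 ->
  (forall k, 0 <= F k) -> F 1%N = F 0%N ->
  (forall k, (k < K)%N -> F k.+2 <= a1 * F k.+1 + a2 * F k) ->
  F K.+1 <= p ^+ K * (1 + (p - a1)) * F 0%N.
Proof.
move=> p0 b0 pb F0 F1 Fr; set b := p - a1 in b0 pb *.
suff H k : (k <= K)%N -> F k.+1 + b * F k <= p ^+ k * (1 + b) * F 0%N.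
  by apply: le_trans (H K (leqnn _)); rewrite lerDl mulr_ge0.
elim: k => [_|k IH kK]; first by rewrite F1 expr0; lra.
have := ler_wpM2l p0 (IH (ltnW kK)); have := Fr k kK.
by rewrite exprS -pb /b; nra.
Qed.

(** With a = e - t g and [d] the slack in the hypothesis, the right side minus the left is exactly w
    |a + e'|^2 + w^2 |e + e'|^2 + (2 + 4 w) d. The weight of [d] is 2 (1 + 2 w), as |a|^2 is used 1
    + 2 w times. *)
Lemma momentum_step n (e e' g : 'cV[R]_n) (t w xi : R) : 0 <= w ->
  (1 - xi) * (t ^+ 2 * edot g g) <= t * edot e g ->
  edot (e - t *: g + w *: (e - e')) (e - t *: g + w *: (e - e'))
    <= (1 + 3 * w + 2 * w ^+ 2) * edot e e + (w + 2 * w ^+ 2) * edot e' e'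
       - (1 - 2 * xi + 3 * w - 4 * w * xi) * (t ^+ 2 * edot g g).
Proof.
move=> w0 h; rewrite -subr_ge0.
have := edot_ge0 (e - t *: g + e'); have := edot_ge0 (e + e').
set s1 := edot (e + e') _; set s2 := edot (e - _ + e') _ => s1_ge0 s2_ge0.
set d := t * edot e g - (1 - xi) * (t ^+ 2 * edot g g).
have d_ge0 : 0 <= d by rewrite subr_ge0.
have := addr_ge0 (addr_ge0 (mulr_ge0 w0 s2_ge0) (mulr_ge0 (sqr_ge0 w) s1_ge0))
  (mulr_ge0 (_ : 0 <= 2 + 4 * w) d_ge0).
move=> /(_ ltac:(lra))/le_trans; apply.
rewrite le_eqVlt; apply/orP; left; apply/eqP.
rewrite /s1 /s2 /d !(edotDl, edotDr, edotNl, edotNr, edotZl, edotZr).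
rewrite (edotC g e) (edotC e' e) (edotC e' g); ring.
Qed.

End MomentumRecursion.

(** * A Kaczmarz step with general weights *)

Section WeightedKaczmarz.
Context (R : realType) (m n : nat).
Implicit Types (A : 'M[R]_(m, n)) (h r : 'cV[R]_m).

(** The columns of [cokermx A] lie in the kernel of A, so B annihilates them, which amounts to
    row-space inclusion. *)
Lemma kernel_submx p A (B : 'M[R]_(p, n)) :
  (forall v : 'cV[R]_n, A *m v = 0 -> B *m v = 0) -> (B <= A)%MS.
Proof.
move=> AB; rewrite submxE; apply/eqP/matrixP => i j; rewrite [RHS]mxE.
have : B *m col j (cokermx A) = 0.
  by apply: AB; rewrite colE mulmxA mulmx_coker mul0mx.
by rewrite colE mulmxA -colE => /matrixP/(_ i 0); rewrite !mxE.
Qed.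

(** Expanding |r_i + r_j|^2 >= 0 and |r_i - r_j|^2 >= 0 bounds a Gram entry by the mean of two
    squared row norms. *)
Lemma edot_row_le A i j alpha : (forall i, enorm (row i A) ^+ 2 <= alpha) ->
  `|(A *m A^T) i j| <= alpha.
Proof.
move=> Aa; have -> : (A *m A^T) i j = edot (row i A) (row j A).
  by rewrite edotE big_ord1 mxE; apply: eq_bigr => k _; rewrite !mxE.
have := Aa i; have := Aa j; rewrite !sqr_enorm ler_norml => hi hj.
have := edot_ge0 (row i A + row j A); have := edot_ge0 (row i A - row j A).
rewrite !edotDD !edotNr edotNl => h1 h2.
by apply/andP; split; lra.
Qed.

(** |A^T h|^2 is the quadratic form at h of the Gram matrix A A^T, whose entries are at most alpha
    in absolute value. *)
Lemma sqr_enorm_trmulmx_le A h alpha :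
  (forall i, enorm (row i A) ^+ 2 <= alpha) ->
  edot (A^T *m h) (A^T *m h) <= alpha * (\sum_i `|h i 0|) ^+ 2.
Proof.
move=> Aa; rewrite edot_mulr trmxK mulmxA edotC edotE.
set H := \sum_i `|h i 0|.
have -> : alpha * H ^+ 2 = \sum_i `|h i 0| * (alpha * H).
  by rewrite -mulr_suml -/H; ring.
apply: ler_sum => i _; rewrite big_ord1; apply: le_trans (ler_norm _) _.
rewrite normrM ler_wpM2l // mxE mulr_sumr.
apply: le_trans (ler_norm_sum _ _ _) _.
by apply: ler_sum => j _; rewrite normrM ler_wpM2r //; exact: edot_row_le.
Qed.

(* S = h . r dominates c * sum |h_i|, while |A^T h|^2 is at most
   alpha * (sum |h_i|)^2. *)
Lemma weighted_kaczmarz A h r (e : 'cV[R]_n) (xi c alpha : R) :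
  0 <= xi < 1 -> 0 < c -> h != 0 ->
  (forall i, 0 <= h i 0 * r i 0) ->
  (forall i, h i 0 != 0 -> c <= `|r i 0|) ->
  (forall i, `|r i 0 - (A *m e) i 0| <= xi * `|r i 0|) ->
  (forall i, enorm (row i A) ^+ 2 <= alpha) ->
  let g := A^T *m h in let t := edot h r / enorm g ^+ 2 in
  c ^+ 2 <= alpha * (t ^+ 2 * edot g g) /\
  (1 - xi) * (t ^+ 2 * edot g g) <= t * edot e g.
Proof.
move=> /andP[xi0 xi1] c0 h0 hr hc re Aa g t.
have Se (u : 'cV[R]_m) : edot h u = \sum_i h i 0 * u i 0.
  by rewrite edotE; apply: eq_bigr => i _; rewrite big_ord1.
have [i0 hi0] : exists i, h i 0 != 0.
  apply/existsP; apply: contraR h0 => /existsPn h0; apply/eqP/matrixP => i j.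
  by rewrite (ord1 j) [RHS]mxE; apply/eqP; have := h0 i; rewrite negbK.
pose H := \sum_i `|h i 0|.
have H0 : 0 < H.
  rewrite /H (bigD1 i0) //= ltr_wpDr ?normr_gt0 //.
  by apply: sumr_ge0 => i _; rewrite normr_ge0.
have cS : c * H <= edot h r.
  rewrite Se mulr_sumr; apply: ler_sum => i _.
  rewrite -[leRHS]ger0_norm // normrM.
  have [->|hi] := eqVneq (h i 0) 0; first by rewrite normr0 mulr0 mul0r.
  by rewrite mulrC ler_wpM2l // hc.
have S0 : 0 < edot h r by apply: lt_le_trans cS; rewrite mulr_gt0.
(* Since <e, g> = <A e, h>, the cone estimate is weighted by h_i and summed; h_i r_i >= 0 fixes the
   signs. *)
have eg : (1 - xi) * edot h r <= edot e g.
  rewrite (edotC e) /g edot_mull trmxK !Se mulr_sumr; apply: ler_sum => i _.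
  have : `|h i 0 * r i 0 - h i 0 * (A *m e) i 0| <= xi * (h i 0 * r i 0).
    rewrite -mulrBr normrM -[in leRHS](ger0_norm (hr i)) normrM mulrCA.
    by rewrite ler_wpM2l.
  by move=> /(le_trans (ler_norm _)); lra.
(* <e, g> > 0 excludes g = 0, so the denominator of t is nonzero. *)
have g0 : 0 < edot g g.
  rewrite lt0r edot_ge0 andbT; apply/eqP => /edot_eq0 g0.
  have : 0 < edot e g by apply: lt_le_trans eg; rewrite mulr_gt0 ?subr_gt0.
  by rewrite g0 /edot mulmx0 mxtrace0 ltxx.
have tE : t ^+ 2 * edot g g = edot h r ^+ 2 / edot g g.
  by rewrite /t sqr_enorm; field; exact: lt0r_neq0.
rewrite tE; split.
  rewrite mulrA ler_pdivlMr //.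
  have Hg : edot g g <= alpha * H ^+ 2 by exact: sqr_enorm_trmulmx_le.
  have a0 : 0 <= alpha by apply: le_trans (Aa i0); rewrite sqr_ge0.
  apply: (le_trans (ler_wpM2l (sqr_ge0 c) Hg)).
  rewrite mulrCA -exprMn ler_wpM2l // ler_pXn2r ?nnegrE //; last exact: ltW.
  by rewrite mulr_ge0 // ltW.
have := ler_wpM2l (ltW (divr_gt0 S0 g0)) eg; rewrite /t sqr_enorm.
by apply: le_trans; rewrite le_eqVlt; apply/orP; left; apply/eqP; ring.
Qed.

End WeightedKaczmarz.

(** * The index set tau_k and the weights eta_k *)

Section RBWNKmStep.
Context (R : realType) (m n : nat).
Implicit Types (f : 'cV[R]_n -> 'cV[R]_m) (x : 'cV[R]_n).

(* The weights eta_k, extended by 0 outside tau_k. *)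
Definition rbwnk_mask (q : nat) f x : 'cV[R]_m :=
  \col_i (if i \in rbwnk_tau f x then rbwnk_weight q (f x i 0) else 0).

(** Reindexing along [enum_val] and padding with zeros outside [tau] removes the dependent dimension
    [#|tau|]. *)
Lemma rowsub_restr_mul (tau : {set 'I_m}) p r (A : 'M[R]_(m, p))
    (B : 'M[R]_(m, r)) :
  (rowsub (restr (tau := tau)) A)^T *m rowsub (restr (tau := tau)) B
    = A^T *m \matrix_(i, j) (if i \in tau then B i j else 0).
Proof.
apply/matrixP => i j; rewrite !mxE.
under eq_bigr do rewrite !mxE.
under [RHS]eq_bigr do rewrite !mxE.
rewrite -(big_enum_val (A := mem tau) (fun k => A k i * B k j)) big_mkcond.
by apply: eq_bigr => k _; case: ifP => //; rewrite mulr0.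
Qed.

Lemma rbwnk_mask_dir q f x (A : 'M[R]_(m, n)) :
  (rowsub (restr (tau := rbwnk_tau f x)) A)^T *m rbwnk_eta q f x
    = A^T *m rbwnk_mask q f x.
Proof.
rewrite /rbwnk_eta map_mxsub rowsub_restr_mul; congr (_ *m _).
by apply/matrixP => i j; rewrite (ord1 j) !mxE.
Qed.

Lemma rbwnk_mask_dot q f x :
  ((rbwnk_eta q f x)^T *m rowsub (restr (tau := rbwnk_tau f x)) (f x)) 0 0
    = edot (rbwnk_mask q f x) (f x).
Proof.
rewrite /rbwnk_eta map_mxsub rowsub_restr_mul mxE edotE.
apply: eq_bigr => i _; rewrite big_ord1 !mxE.
by case: ifP => //; rewrite mulr0 mul0r.
Qed.

(** The product is |a|^q for either parity of q. *)
Lemma rbwnk_weight_mul_gt0 q (a : R) : (2 <= q)%N -> a != 0 ->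
  0 < rbwnk_weight q a * a.
Proof.
move=> q2 a0; rewrite /rbwnk_weight; case: ifPn => qodd.
  by rewrite -mulrA -expr2 mulr_gt0 ?normr_gt0 ?expf_neq0 // exprn_even_gt0.
by rewrite -exprSr subn1 prednK ?exprn_even_gt0 ?a0 ?orbT // (leq_trans _ q2).
Qed.

Lemma sqr_enorm_cV (v : 'cV[R]_m) : enorm v ^+ 2 = \sum_i `|v i 0| ^+ 2.
Proof.
rewrite sqr_enorm edotE; apply: eq_bigr => i _.
by rewrite big_ord1 -expr2 real_normK ?num_real.
Qed.

(** The threshold is the midpoint of the largest squared residual and the mean one. It thus lies
    between them: a maximising index passes, and every index that passes is above the mean. *)
Lemma rbwnk_tau_spec f x : (0 < m)%N -> f x != 0 ->
  (exists i, i \in rbwnk_tau f x) /\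
  (forall i, i \in rbwnk_tau f x -> enorm (f x) ^+ 2 / m%:R <= `|f x i 0| ^+ 2).
Proof.
move=> m0 fx0; have E0 : 0 < enorm (f x) ^+ 2.
  rewrite sqr_enorm lt0r edot_ge0 andbT.
  by apply: contra fx0 => /eqP/edot_eq0 ->.
set M := \big[Num.max/0]_(i < m) `|f x i 0| ^+ 2.
have mR : 0 < m%:R :> R by rewrite ltr0n.
have EM : enorm (f x) ^+ 2 / m%:R <= M.
  rewrite ler_pdivrMr // sqr_enorm_cV mulr_natr.
  rewrite -[X in M *+ X]card_ord -sumr_const; apply: ler_sum => i _.
  by apply: le_bigmax.
have dE : rbwnk_delta f x * enorm (f x) ^+ 2
    = (M + enorm (f x) ^+ 2 / m%:R) / 2.
  rewrite /rbwnk_delta -/M; move: (enorm (f x) ^+ 2) E0 => E E0.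
  by field; rewrite !lt0r_neq0.
split=> [|i]; last by rewrite inE dE; apply: le_trans; lra.
have [i Mi] : exists i, M <= `|f x i 0| ^+ 2.
  (* [Ordinal m0] makes the index type nonempty; as the terms are nonnegative, the default 0 does
     not change the maximum. *)
  have [i _ Mi] := @Order.TotalTheory.eq_bigmax _ R _ _ (Ordinal m0) xpredT
    (fun i => `|f x i 0| ^+ 2) isT (fun _ _ => sqr_ge0 _).
  by exists i; rewrite -Mi.
by exists i; rewrite inE dE; apply: le_trans Mi; lra.
Qed.

End RBWNKmStep.

(** As q >= 2, m^(1-q) s^2 F <= s^2 F / m <= (1 + xi)^2 E / m <= alpha (1 + xi)^2 T. The coefficient
    of T is nonnegative for xi <= 1/2, so the T term can be absorbed into the coefficient of F. *)
Lemma contraction_rate (R : realType) (m q : nat) (w xi alpha s E T F F' : R) :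
  (0 < m)%N -> (2 <= q)%N -> 0 <= w -> 0 <= xi <= 2^-1 -> 0 <= alpha ->
  0 < E -> 0 <= F -> E / m%:R <= alpha * T ->
  s ^+ 2 * F <= (1 + xi) ^+ 2 * E ->
  (1 + 3 * w + 2 * w ^+ 2) * F + (w + 2 * w ^+ 2) * F'
    - (1 - 2 * xi + 3 * w - 4 * w * xi) * T
  <= (1 + 3 * w + 2 * w ^+ 2
      - (1 - 2 * xi + 3 * w - 4 * w * xi)
        * ((m%:R ^ (1 - q%:Z) * s ^+ 2) / (alpha * (1 + xi) ^+ 2))) * F
     + (w + 2 * w ^+ 2) * F'.
Proof.
move=> m0 q2 w0 /andP[xi0 xi2] alpha_ge0 E0 F0 ET sFE.
have m0R : 0 < m%:R :> R by rewrite ltr0n.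
have alpha_gt0 : 0 < alpha.
  rewrite lt0r alpha_ge0 andbT; apply/eqP => alpha0.
  by move: ET; rewrite alpha0 mul0r leNgt divr_gt0.
have xi1 : 0 < (1 + xi) ^+ 2 by rewrite exprn_gt0 // ltr_wpDr.
have mq : m%:R ^ (1 - q%:Z) <= m%:R^-1 :> R.
  by rewrite -exprN1; apply: ler_weXz2l; [rewrite ler1n | lia].
have rhoT : m%:R ^ (1 - q%:Z) * s ^+ 2 / (alpha * (1 + xi) ^+ 2) * F <= T.
  rewrite mulrAC ler_pdivrMr; last exact: mulr_gt0.
  rewrite -[leLHS]mulrA.
  have sF : 0 <= s ^+ 2 * F by rewrite mulr_ge0 // sqr_ge0.
  apply: le_trans (ler_wpM2r sF mq) _.
  have mV0 : 0 <= m%:R^-1 :> R by rewrite invr_ge0 ltW.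
  apply: le_trans (ler_wpM2l mV0 sFE) _.
  have := ler_wpM2l (ltW xi1) ET.
  have -> : (1 + xi) ^+ 2 * (E / m%:R) = m%:R^-1 * ((1 + xi) ^+ 2 * E) by ring.
  move=> /le_trans; apply.
  by rewrite le_eqVlt; apply/orP; left; apply/eqP; ring.
move: (_ / (alpha * _)) rhoT => rho rhoT.
have C0 : 0 <= 1 - 2 * xi + 3 * w - 4 * w * xi by nra.
by have := ler_wpM2l C0 rhoT; lra.
Qed.

(** * Error and residual bounds for one iteration *)

Section RBWNKmDescent.
Context (R : realType) (m n : nat).

(** [weighted_kaczmarz], with r = f x, h the masked weights and c = |f x| / sqrt m, provides the
    hypothesis of [momentum_step]; the witness is T = t^2 |g|^2. *)
Lemma rbwnkm_step_bound (q : nat) (omega xi alpha : R)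
    (f : 'cV[R]_n -> 'cV[R]_m) (J : 'cV[R]_n -> 'M[R]_(m, n))
    (x xprev xd : 'cV[R]_n) :
  (0 < m)%N -> (2 <= q)%N -> 0 <= omega -> 0 <= xi < 1 -> f x != 0 ->
  (forall i, `|f x i 0 - (J x *m (x - xd)) i 0| <= xi * `|f x i 0|) ->
  (forall i, enorm (row i (J x)) ^+ 2 <= alpha) ->
  exists2 T, enorm (f x) ^+ 2 / m%:R <= alpha * T &
    enorm (rbwnkm_step q omega f J x xprev - xd) ^+ 2
      <= (1 + 3 * omega + 2 * omega ^+ 2) * enorm (x - xd) ^+ 2
         + (omega + 2 * omega ^+ 2) * enorm (xprev - xd) ^+ 2
         - (1 - 2 * xi + 3 * omega - 4 * omega * xi) * T.
Proof.
move=> m0 q2 w0 xi01 fx0 cone Ja.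
have [[i0 i0tau] tau_ge] := rbwnk_tau_spec m0 fx0.
have E0 : 0 < enorm (f x) ^+ 2 / m%:R.
  rewrite divr_gt0 ?ltr0n // sqr_enorm lt0r edot_ge0 andbT.
  by apply: contra fx0 => /eqP/edot_eq0 ->.
set c2 := _ / _ in E0 tau_ge *.
have f_neq0 i : i \in rbwnk_tau f x -> f x i 0 != 0.
  by move=> /tau_ge; apply: contraTneq => ->; rewrite normr0 expr0n -ltNge.
pose h := rbwnk_mask q f x.
have hE i : h i 0 = if i \in rbwnk_tau f x then rbwnk_weight q (f x i 0) else 0.
  by rewrite mxE.
have h0 : h != 0.
  apply/eqP => /matrixP/(_ i0 0); rewrite hE i0tau mxE => w0'.
  by have := rbwnk_weight_mul_gt0 q2 (f_neq0 _ i0tau); rewrite w0' mul0r ltxx.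
have hr i : 0 <= h i 0 * f x i 0.
  by rewrite hE; case: ifP => [/f_neq0/(rbwnk_weight_mul_gt0 q2)/ltW|];
    rewrite ?mul0r.
have hc i : h i 0 != 0 -> Num.sqrt c2 <= `|f x i 0|.
  rewrite hE; case: ifP => [/tau_ge h2 _|]; last by rewrite eqxx.
  by rewrite -(@ler_pXn2r _ 2) ?nnegrE ?sqrtr_ge0 // sqr_sqrtr // ltW.
have s0 : 0 < Num.sqrt c2 by rewrite sqrtr_gt0.
have [] := weighted_kaczmarz xi01 s0 h0 hr hc cone Ja.
set g := (J x)^T *m h; set t := _ / _; rewrite sqr_sqrtr ?(ltW E0) // => cT tg.
exists (t ^+ 2 * edot g g) => //.
have -> : rbwnkm_step q omega f J x xprev - xd
    = (x - xd) - t *: g + omega *: ((x - xd) - (xprev - xd)).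
  rewrite /rbwnkm_step rbwnk_mask_dir rbwnk_mask_dot -/h -/g -/t.
  have -> : x - xd - (xprev - xd) = x - xprev by rewrite opprB addrA subrK.
  by rewrite addrAC [x - _ - xd]addrAC.
rewrite !sqr_enorm; exact: momentum_step.
Qed.

(** The triangle inequality gives |(A e)_i| <= (1 + xi) |f_i| for e = x - xd, and [sigma_min_le]
    applies since e is in the range of A^T. *)
Lemma cone_residual_ge (f : 'cV[R]_n -> 'cV[R]_m) (A : 'M[R]_(m, n))
    (x xd : 'cV[R]_n) (xi : R) : 0 <= xi ->
  (exists w : 'cV[R]_m, x - xd = A^T *m w) ->
  (forall i, `|f x i 0 - (A *m (x - xd)) i 0| <= xi * `|f x i 0|) ->
  sigma_min A ^+ 2 * enorm (x - xd) ^+ 2 <= (1 + xi) ^+ 2 * enorm (f x) ^+ 2.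
Proof.
move=> xi0 [w xw] cone; rewrite {1}xw.
apply: le_trans (sigma_min_le A w) _; rewrite -xw !sqr_enorm_cV mulr_sumr.
apply: ler_sum => i _; rewrite -exprMn ler_pXn2r ?nnegrE ?mulr_ge0 ?addr_ge0 //.
have -> : (A *m (x - xd)) i 0 = f x i 0 - (f x i 0 - (A *m (x - xd)) i 0).
  by rewrite subKr.
by apply: le_trans (ler_normB _ _) _; rewrite mulrDl mul1r lerD2l.
Qed.

(** [sup] dominates a set only when the set is bounded above; here J is bounded on the compact set
    D. *)
Lemma sqr_enorm_row_le_sup (D : set 'cV[R]_n) (J : 'cV[R]_n -> 'M[R]_(m, n)) :
  compact D -> {within D, continuous J} -> forall y i, D y ->
  enorm (row i (J y)) ^+ 2 <=
    \big[Num.max/0]_(i < m) sup [set enorm (row i (J y)) ^+ 2 | y in D].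
Proof.
move=> Dc Jc y i Dy.
apply: le_trans (le_bigmax _ _ i); apply: ub_le_sup; last by exists y.
have [M [_ MJ]] := compact_bounded (continuous_compact Jc Dc).
(* Every number above M bounds the entries of J, hence M + 1. *)
exists (\sum_(j < n) (M + 1) ^+ 2) => _ [z Dz <-].
rewrite sqr_enorm edotE big_ord1; apply: ler_sum => j _.
have : `|J z| <= M + 1 by apply: MJ; [rewrite ltrDl | exists z].
rewrite {1}/Num.norm /= mx_normrE => Jz.
have Jij : `|J z i j| <= M + 1 := le_trans (le_bigmax _ _ (i, j)) Jz.
rewrite mxE -expr2 -real_normK ?num_real // ler_pXn2r ?nnegrE //.
exact: le_trans Jij.
Qed.

End RBWNKmDescent.

(** * Linear convergence of the iterates to the solution *)

Unset Implicit Arguments.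

Theorem theorem3p1 (R : realType) (m n : nat) (m_gt0 : (0 < m)%N)
  (D : set 'cV[R]_n) (D_bounded : bounded_set D) (D_closed : closed D)
  (f : 'cV[R]_n -> 'cV[R]_m) (J : 'cV[R]_n -> 'M[R]_(m, n))
  (f_diff : forall x, D x -> jacobian_within D f x (J x))
  (J_cont : {within D, continuous J})
  (xi_ : 'I_m -> R) (xi_ge0 : forall i, 0 <= xi_ i)
  (xi_le : \big[Num.max/0]_(i < m) xi_ i <= 2^-1)
  (f_cone : tangential_cone D f J xi_)
  (xd : 'cV[R]_n) (Dxd : D xd) (fxd : f xd = 0)
  (ker_incl : forall x, D x ->
     forall v : 'cV[R]_n, J xd *m v = 0 -> J x *m v = 0)
  (x0 : 'cV[R]_n) (Dx0 : D x0)
  (xd_min : forall z, D z -> f z = 0 -> enorm (xd - x0) <= enorm (z - x0))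
  (xd_range : exists w : 'cV[R]_m, xd - x0 = (J xd)^T *m w)
  (q : nat) (q_ge2 : (2 <= q)%N)
  (omega : R) (omega_ge0 : 0 <= omega) (omega_lt1 : omega < 1)
  (x : nat -> 'cV[R]_n)
  (x_seq : rbwnkm_sequence q omega f J x0 x)
  (x_in : forall k, generated f x k -> D (x k)) :
  let xi := \big[Num.max/0]_(i < m) xi_ i in
  let alpha := \big[Num.max/0]_(i < m)
                 sup [set enorm (row i (J y)) ^+ 2 | y in D] in
  let a1 := 1 + 3 * omega + 2 * omega ^+ 2
            - (1 - 2 * xi + 3 * omega - 4 * omega * xi)
              * ((m%:R ^ (1 - q%:Z) * sigma_min (J xd) ^+ 2)
                 / (alpha * (1 + xi) ^+ 2)) in
  let a2 := omega + 2 * omega ^+ 2 in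
  let p1 := (a1 + Num.sqrt (a1 ^+ 2 + 4 * a2)) / 2 in
  let b1 := p1 - a1 in
  a1 + a2 < 1 ->
  [/\ a1 + a2 <= p1, p1 < 1
    & forall k, (1 <= k)%N -> generated f x k.+1 ->
        enorm (x k.+1 - xd) ^+ 2
          <= p1 ^+ k * (1 + b1) * enorm (x0 - xd) ^+ 2].
Proof.
move=> xi alpha a1 a2 p1 b1 a12_lt1.
have xiI i : xi_ i <= xi by exact: le_bigmax.
have xi0 : 0 <= xi by apply: bigmax_ge_id.
have xi01 : 0 <= xi < 1 by rewrite xi0 /=; move: xi_le; rewrite -/xi; lra.
have a2_ge0 : 0 <= a2 by rewrite addr_ge0 // mulr_ge0 // sqr_ge0.
have [p_ge p_lt1 p_ge0 b_ge0 pb] := momentum_root a2_ge0 a12_lt1.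
split=> // k k1 gk.
(* Earlier iterates are generated too, so [x_in] places all of x_0, ..., x_(k+1) in D. *)
have gen j : (j <= k.+1)%N -> generated f x j.
  by move=> jk i /andP[i1 ij]; apply: gk; rewrite i1 (leq_trans ij).
have Dx j : (j <= k.+1)%N -> D (x j) by move/gen/x_in.
have [x_0 x_1 x_S] := x_seq.
have cone y z i : D y -> D z ->
    `|f y i 0 - f z i 0 - (J y *m (y - z)) i 0| <= xi * `|f y i 0 - f z i 0|.
  move=> Dy Dz; have := f_cone y z i Dy Dz; rewrite -row_mul mxE => /le_trans.
  by apply; rewrite ler_wpM2r.
have xd0 i : f xd i 0 = 0 by rewrite fxd mxE.
have row_le y : D y -> forall i, enorm (row i (J y)) ^+ 2 <= alpha.
  move=> Dy i; apply: sqr_enorm_row_le_sup => //.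
  exact: cV_bounded_closed_compact.
(* Induction over two predecessors, because of the momentum term. *)
have range j : (j <= k.+1)%N -> exists w : 'cV[R]_m, x j - xd = (J xd)^T *m w.
  have r0 : exists w : 'cV[R]_m, x0 - xd = (J xd)^T *m w.
    have [w xw] := xd_range; exists (- w).
    by rewrite mulmxN -xw opprB.
  elim/ltn_ind: j => -[|[|j]] IH jk; rewrite ?x_0 ?x_1 //.
  have [w wE] := IH j.+1 (ltnSn _) (ltnW jk).
  have [w' wE'] := IH j (ltnW (ltnSn _)) (ltnW (ltnW jk)).
  rewrite x_S //; last exact: gen.
  rewrite /rbwnkm_step rbwnk_mask_dir /=; set t := _ / _.
  (* Kernel inclusion factors J(x_(j+1)) as B J(xd), which puts the step direction in the range of
     J(xd)^T. *)
  have /submxP[B JB] : (J (x j.+1) <= J xd)%MS.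
    by apply: kernel_submx => v; apply: ker_incl; apply: Dx; exact: ltnW.
  exists (w - t *: (B^T *m rbwnk_mask q f (x j.+1)) + omega *: (w - w')).
  rewrite mulmxDr mulmxBr -!scalemxAr mulmxBr -wE -wE' mulmxA -trmx_mul -JB.
  have -> : x j.+1 - xd - (x j - xd) = x j.+1 - x j.
    by rewrite opprB addrA subrK.
  by rewrite addrAC [x j.+1 - _ - xd]addrAC.
pose F j := enorm (x j - xd) ^+ 2.
have F10 : F 1%N = F 0%N by rewrite /F x_0 x_1.
have -> : enorm (x0 - xd) ^+ 2 = F 0%N by rewrite /F x_0.
apply: (@momentum_recursion R a1 a2 p1 F k p_ge0 b_ge0 pb _ F10 _) => [j|j jk].
  by rewrite sqr_ge0.
have fxj : f (x j.+1) != 0 by apply/eqP; exact: gk.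
have Dj : D (x j.+1) by apply: Dx; exact: ltnW.
(* The cone condition is used here with the derivative at the iterate. *)
have [] := @rbwnkm_step_bound _ _ _ q omega xi alpha f J (x j.+1) (x j) xd
  m_gt0 q_ge2 omega_ge0 xi01 fxj.
- by move=> i; have := cone (x j.+1) xd i Dj Dxd; rewrite xd0 subr0.
- exact: row_le.
move=> T fT; rewrite /F (x_S j.+1 isT (gen j.+2 jk)).
move=> /le_trans; apply; rewrite /= -!/(F _).
(* Here the cone condition is used with the derivative at xd, so that the singular value of J(xd)
   appears. *)
have res : sigma_min (J xd) ^+ 2 * F j.+1
    <= (1 + xi) ^+ 2 * enorm (f (x j.+1)) ^+ 2.
  apply: cone_residual_ge => //; first by apply: range; exact: ltnW.
  move=> i; have := cone xd (x j.+1) i Dxd Dj; rewrite xd0 sub0r normrN.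
  have -> : (J xd *m (xd - x j.+1)) i 0 = - (J xd *m (x j.+1 - xd)) i 0.
    by rewrite -opprB mulmxN mxE.
  by rewrite -opprD normrN.
have f0 : 0 < enorm (f (x j.+1)) ^+ 2.
  rewrite sqr_enorm lt0r edot_ge0 andbT.
  by apply: contra fxj => /eqP/edot_eq0 ->.
have alpha_ge0 : 0 <= alpha by exact: bigmax_ge_id.
apply: contraction_rate fT res => //.
- by rewrite xi0.
- exact: sqr_ge0.
Qed.
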